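(* Let $0\le a<b\le 1$, let $W=(W_t)_{t\in[0,1]}$ be a Brownian motion and let $\{\mathcal{F}_t\}$ be the filtration generated by $W$. Let $\Theta(x,y)$ be a real-valued function on $\mathbb{R}^2$ that is continuous in both variables such that the Ayed--Kuo stochastic integral $$N_t=\int_a^t \Theta(W_s,\,W_b-W_s)\,dW_s,\qquad a\le t\le b,$$ exists and $\mathbb{E}|N_t|<\infty$ for each $t\in[a,b]$. Furthermore, assume that the family of partial sums $$\sum_{i=1}^n \Theta(W_{t_{i-1}},\,W_b-W_{t_i})\,(W_{t_i}-W_{t_{i-1}}),$$ taken over partitions $s=t_0<t_1<\dots<t_n=t$ of subintervals $[s,t]\subseteq[a,b]$, is uniformly integrable. Then $N_t$, $a\le t\le b$, is a near-martingale with respect to $\{\mathcal{F}_t\}$.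
   Context: Near-martingale: an integrable stochastic process $N_t$ is a near-martingale with respect to $\{\mathcal{F}_t\}$ if for all $s\le t$, $\mathbb{E}(N_t-N_s\mid\mathcal{F}_s)=0$ almost surely (adaptedness of $N$ is not part of the definition). Instantly independent: a process $\phi(t)$ is instantly independent with respect to $\{\mathcal{F}_t\}$ if for each $t$ the random variable $\phi(t)$ and the $\sigma$-field $\mathcal{F}_t$ are independent. Ayed--Kuo integral over an interval $[\alpha,\beta]$ is defined in three steps. (1) If $f(t)$ is a continuous $\{\mathcal{F}_t\}$-adapted process and $\phi(t)$ is a continuous process that is instantly independent with respect to $\{\mathcal{F}_t\}$, then $$\int_\alpha^\beta f(t)\phi(t)\,dW_t=\lim_{\|\Delta_n\|\to0}\sum_{j=1}^n f(t_{j-1})\phi(t_j)(W_{t_j}-W_{t_{j-1}})$$ (partitions $\Delta_n=\{\alpha=t_0<\dots<t_n=\beta\}$), provided the limit exists in probability. (2) For $\Phi(t)=\sum_{i=1}^n f_i(t)\phi_i(t)$ with $f_i,\phi_i$ as in (1), $\int_\alpha^\beta\Phi(t)\,dW_t=\sum_{i=1}^n\int_\alpha^\beta f_i(t)\phi_i(t)\,dW_t$. (3) If $\Phi(t)$ is a process for which there is a sequence $(\Phi_n)$ of processes as in (2) with $\int_\alpha^\beta|\Phi_n(t)-\Phi(t)|^2\,dt\to0$ almost surely and $\int_\alpha^\beta\Phi_n(t)\,dW_t$ convergent in probability, then $\int_\alpha^\beta\Phi(t)\,dW_t$ is the limit in probability of $\int_\alpha^\beta\Phi_n(t)\,dW_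t$.
   Formalization: Added hypothesis: for each t in [a,b], N_t is the limit in probability of the displayed partial sums over partitions of [a,t]; step (3) alone does not determine the integral (for Θ=0 it also allows N_t=-(t-a), which is not a near-martingale). *)

(* Defs.v *)
From HB Require Import structures.
From mathcomp Require Import all_boot all_order all_algebra.
From mathcomp Require Import all_classical all_reals all_analysis.

Set Implicit Arguments.
Unset Strict Implicit.
Unset Printing Implicit Defensive.
Import Order.TTheory GRing.Theory Num.Theory.
Import numFieldNormedType.Exports.
Local Open Scope classical_set_scope.
Local Open Scope ring_scope.

Section Definitions.
Context {d : measure_display} {T : measurableType d} {R : realType}.
Variable P : probability T R.

(* A process is a family X : R -> T -> R, of which only the values at times in
   the relevant interval matter; a filtration is a family F : R -> set (set T)
   of sigma-algebras on T. *)

Definition mutually_independent (I : finType) (X : I -> T -> R) : Prop :=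
  forall B : I -> set R, (forall i, measurable (B i)) ->
    P (\bigcap_i (X i @^-1` B i)) = (\prod_i P (X i @^-1` B i))%E.

Definition continuous_process (alpha beta : R) (X : R -> T -> R) : Prop :=
  {ae P, forall w,
    {within `[alpha, beta]%classic, continuous (fun t => X t w)}}.

(* Standard Brownian motion on the time interval [0, 1]. The second parameter
   of normal_prob is the standard deviation. *)
Record brownian_motion (W : R -> T -> R) : Prop := BrownianMotion {
  bm_measurable : forall t, t \in `[0, 1] -> measurable_fun setT (W t);
  bm_start : {ae P, forall w, W 0 w = 0};
  bm_increments : forall (n : nat) (p : nat -> R),
    0 <= p 0%N -> {homo p : i j / (i <= j)%N >-> i <= j} -> p n <= 1 ->
    mutually_independent (fun (i : 'I_n) w => W (p i.+1) w - W (p i) w);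
  bm_gaussian : forall s t, 0 <= s -> s < t -> t <= 1 ->
    forall B : set R, measurable B ->
      P ((fun w => W t w - W s w) @^-1` B) = normal_prob 0 (Num.sqrt (t - s)) B;
  bm_continuous : continuous_process 0 1 W }.

Definition generated_filtration (W : R -> T -> R) (t : R) : set (set T) :=
  <<s \bigcup_(s in `[0, t]%classic)
        g_sigma_algebra_preimage (W s : T -> R) >>.

Definition measurable_wrt (G : set (set T)) (X : T -> R) : Prop :=
  forall B : set R, measurable B -> G (X @^-1` B).

Definition adapted (F : R -> set (set T)) (alpha beta : R) (f : R -> T -> R) :=
  forall t, t \in `[alpha, beta] -> measurable_wrt (F t) (f t).

Definition instantly_independent (F : R -> set (set T)) (alpha beta : R)
    (phi : R -> T -> R) : Prop :=
  forall t, t \in `[alpha, beta] ->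
    measurable_fun setT (phi t) /\
    forall (A : set T) (B : set R), F t A -> measurable B ->
      (P (A `&` phi t @^-1` B) = P A * P (phi t @^-1` B))%E.

(* Y is a version of the conditional expectation of the integrable random
   variable X given the sub-sigma-algebra G. *)
Definition is_cond_exp (G : set (set T)) (X Y : T -> R) : Prop :=
  [/\ measurable_wrt G Y,
      P.-integrable setT (EFin \o Y) &
      forall A, G A ->
        (\int[P]_(w in A) (Y w)%:E = \int[P]_(w in A) (X w)%:E)%E].

Definition near_martingale (F : R -> set (set T)) (a b : R)
    (N : R -> T -> R) : Prop :=
  (forall t, t \in `[a, b] -> P.-integrable setT (EFin \o N t)) /\
  (forall s t, a <= s -> s <= t -> t <= b ->
    exists2 Y : T -> R,
      is_cond_exp (F s) (fun w => N t w - N s w) Y &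
      {ae P, forall w, Y w = 0}).

Definition uniformly_integrable (S : set (T -> R)) : Prop :=
  (forall X, S X -> measurable_fun setT X) /\
  (forall eps : R, 0 < eps -> exists K : R, forall X, S X ->
    (\int[P]_(w in [set w | (K <= `|X w|)%R]) (`|X w|%R)%:E <= eps%:E)%E).

Definition cvg_in_prob (I : Type) (F : set_system I) (X : I -> T -> R)
    (Y : T -> R) : Prop :=
  forall eps : R, 0 < eps ->
    P [set w | eps <= `|X i w - Y w|] @[i --> F] --> 0%E.

(* Following itv_partition, the partition s = t_0 < ... < t_n = t is encoded
   by the sequence p = [:: t_1; ...; t_n], so t_i = nth t (s :: p) i. *)
Definition mesh_to_0 (alpha beta : R) : set_system (seq R) :=
  fun Q => exists2 delta : R, 0 < delta &
    forall p : seq R, itv_partition alpha beta p ->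
      (forall i, (i < size p)%N ->
        nth beta (alpha :: p) i.+1 - nth beta (alpha :: p) i < delta) -> Q p.

(* H u v is the integrand with its adapted part evaluated at time u (the left
   endpoint) and its instantly independent part at time v (the right one). *)
Definition riemann_sum (W : R -> T -> R) (H : R -> R -> T -> R)
    (alpha beta : R) (p : seq R) (w : T) : R :=
  let t := nth beta (alpha :: p) in
  \sum_(0 <= i < size p) H (t i) (t i.+1) w * (W (t i.+1) w - W (t i) w).

Definition AK_product (W : R -> T -> R) (F : R -> set (set T))
    (alpha beta : R) (f phi : R -> T -> R) (I : T -> R) : Prop :=
  [/\ continuous_process alpha beta f, adapted F alpha beta f,
      continuous_process alpha beta phi,
      instantly_independent F alpha beta phi &
      measurable_fun setT I /\
      cvg_in_prob (mesh_to_0 alpha beta)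
        (riemann_sum W (fun u v w => f u w * phi v w) alpha beta) I].

Definition AK_sum (W : R -> T -> R) (F : R -> set (set T))
    (alpha beta : R) (Phi : R -> T -> R) (I : T -> R) : Prop :=
  exists (n : nat) (f phi : 'I_n -> R -> T -> R) (J : 'I_n -> T -> R),
    [/\ forall i, AK_product W F alpha beta (f i) (phi i) (J i),
        forall t w, t \in `[alpha, beta] ->
          Phi t w = \sum_(i < n) f i t w * phi i t w &
        forall w, I w = \sum_(i < n) J i w].

(* The limit in the last step may depend on the approximating sequence, so the
   integral is a relation: I is a value of the Ayed-Kuo integral of Phi over
   [alpha, beta]. Constant sequences show that it contains AK_sum. *)
Definition AK_integral (W : R -> T -> R) (F : R -> set (set T))
    (alpha beta : R) (Phi : R -> T -> R) (I : T -> R) : Prop :=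
  [/\ {ae P, forall w,
        measurable_fun `[alpha, beta]%classic (fun t => Phi t w)},
      measurable_fun setT I &
      exists (Phin : nat -> R -> T -> R) (In : nat -> T -> R),
      [/\ forall n, AK_sum W F alpha beta (Phin n) (In n),
          {ae P, forall w,
            (\int[lebesgue_measure]_(t in `[alpha, beta]%classic)
               (`|Phin n t w - Phi t w| ^+ 2)%R%:E)%E @[n --> \oo] --> 0%E} &
          cvg_in_prob \oo In I]].

End Definitions.

(* Main.v *)
Require Import Defs.
From HB Require Import structures.
From mathcomp Require Import all_boot all_order all_algebra.
From mathcomp Require Import all_classical all_reals all_analysis.
From mathcomp Require Import measurable_realfun ring lra.
Import Order.TTheory GRing.Theory Num.Theory.
Import numFieldNormedType.Exports.
Local Open Scope classical_set_scope.
Local Open Scope ring_scope.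

(** The conditional expectation of N_t - N_s given F_s is shown to be the null
    function: for every A in F_s the integral of N_t - N_s over A vanishes.

    The heart of the matter is that every Riemann sum over [s, t] already
    integrates to 0 over A.  Its terms are U V, where
    V = W_v - W_u is a Brownian increment and
    U = 1_A Theta(W_u, W_b - W_v) depends only on the path up to u and on the
    increment after v.  Increments over disjoint intervals being independent,
    V is independent of U ([brownian_increment_indep]); as V is a centered
    Gaussian, (U, V) and (U, -V) have the same law, so E[U V] = - E[U V]
    ([integral_indep_symmetric]).  Symmetry replaces the product formula
    E[U V] = E[U] E[V], which would require U to be integrable.  Only the
    product U V has to be, and it is: each term of a Riemann sum is itself the
    Riemann sum of a one-step partition, hence belongs to the uniformly
    integrable family ([integral_riemann_sum]).

    It remains to pass to the limit.  A Riemann sum over [a, t] along a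
    partition passing through s splits at s, so fine Riemann sums over [s, t]
    approximate N_t - N_s in probability; by uniform integrability they do so
    in L^1 as well ([uniformly_integrable_limit]), and the integral over A of
    the limit is 0. *)

(** * Borel functions of the plane and the centered Gaussian law *)

(** An open set of the plane is a countable union of open boxes with rational
    corners, and boxes belong to the product sigma-algebra. *)
Lemma continuous_measurable_fun2 {R : realType} (f : R * R -> R) :
  continuous f -> measurable_fun setT f.
Proof.
move=> cf; apply: (measurability _ (RGenOpens.measurableE R)).
move=> _ [_ [x [y ->]] <-]; rewrite setTI.
set U := _ @^-1` _.
have oU : open U by move/continuousP : cf; apply; exact: interval_open.
pose box (q : (rat * rat) * (rat * rat)) : set (R * R) :=
  `]ratr q.1.1, ratr q.1.2[%classic `*` `]ratr q.2.1, ratr q.2.2[%classic.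
suff -> : U = \bigcup_q [set z | box q `<=` U /\ box q z].
  apply: countable_bigcupT_measurable => // q.
  have [qU|qU] := pselect (box q `<=` U).
    rewrite (_ : [set z | _] = box q); first exact: measurableX.
    by apply/seteqP; split=> z // [].
  by rewrite (_ : [set z | _] = set0)//; apply/seteqP; split=> z // [].
apply/seteqP; split=> [[z1 z2] Uz|z [q _ [/[apply]]]//].
have : nbhs (z1, z2) U by exact: open_nbhs_nbhs.
rewrite -nbhs_ballE => -[e /= e0 ballU].
have oo (z : R) : exists q r : rat,
    (ratr q < z < ratr r) /\ (`]ratr q, ratr r[%classic `<=` ball z e).
  have [q] := rat_in_itvoo (ltac:(by rewrite ltrBlDr ltrDl) : z - e < z).
  have [r] := rat_in_itvoo (ltac:(by rewrite ltrDl) : z < z + e).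
  rewrite !in_itv/= => /andP[zr re] /andP[eq qz].
  exists q, r; split; first by rewrite qz.
  move=> w /=; rewrite in_itv/= => /andP[qw wr].
  by rewrite /ball/= ltr_norml ltrBrDl ltrBlDr; apply/andP; split; lra.
have [q1 [r1 [zqr1 b1]]] := oo z1.
have [q2 [r2 [zqr2 b2]]] := oo z2.
exists ((q1, r1), (q2, r2)) => //; split => //.
by move=> [w1 w2] [/= w1b w2b]; apply: ballU; split; [exact: b1|exact: b2].
Qed.

(** The centered Gaussian density is even and Lebesgue measure is invariant
    under reflection. *)
Lemma normal_prob_oppr {R : realType} (s : R) (B : set R) : s != 0 ->
  measurable B -> normal_prob 0 s (-%R @^-1` B) = normal_prob 0 s B.
Proof.
move=> s0 mB; rewrite /normal_prob.
transitivity (\int[pushforward lebesgue_measure (-%R : _ -> measurableTypeR R)]_(x in B)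
   (normal_pdf 0 s x)%:E)%E; last first.
  by apply: eq_measure_integral => A mA _; exact: lebesgue_measureN.
rewrite ge0_integral_pushforward//=.
- apply: eq_integral => x _; rewrite !normal_pdfE// /normal_fun.
  by rewrite !subr0 sqrrN.
- by apply/measurable_EFinP; apply: measurable_funTS; exact: measurable_normal_pdf.
- by move=> x _; rewrite lee_fin normal_pdf_ge0.
Qed.

Section Probability.
Context {d : measure_display} {T : measurableType d} {R : realType}
  {P : probability T R}.

(** * Independence *)

(** By independence and symmetry, (U, V) and (U, -V) both have the product of
    the laws of U and V as joint law; integrating (x, y) |-> x y against it
    gives E[U V] = - E[U V]. *)
Lemma integral_indep_symmetric (U V : T -> R) :
  measurable_fun setT U -> measurable_fun setT V ->
  (forall B D : set R, measurable B -> measurable D ->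
    P (U @^-1` B `&` V @^-1` D) = P (U @^-1` B) * P (V @^-1` D))%E ->
  (forall D : set R, measurable D -> P (V @^-1` (-%R @^-1` D)) = P (V @^-1` D)) ->
  P.-integrable setT (fun w => (U w * V w)%:E) ->
  (\int[P]_w (U w * V w)%:E = 0)%E.
Proof.
move=> mU mV indep symV intUV.
have mN : measurable_fun setT (fun w => - V w) by exact: measurable_funN.
pose UV w := (U w, V w); pose UNV w := (U w, - V w).
have mUV : measurable_fun setT UV by exact: measurable_fun_pair.
have mUNV : measurable_fun setT UNV by exact: measurable_fun_pair.
pose X : {mfun T >-> R} := HB.pack U (isMeasurableFun.Build _ _ _ _ _ mU).
pose Y : {mfun T >-> R} := HB.pack V (isMeasurableFun.Build _ _ _ _ _ mV).
have prodUV := @product_measure_unique _ _ _ _ _ (distribution P X)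
  (distribution P Y) (pushforward P UV) indep.
have indepN (B D : set R) : measurable B -> measurable D ->
    pushforward P UNV (B `*` D) = (distribution P X B * distribution P Y D)%E.
  move=> mB mD; rewrite /distribution /pushforward/= -[in RHS]symV//.
  rewrite -indep//.
  by rewrite -[_ @^-1` D]setTI; exact: oppr_measurable.
have prodUNV := @product_measure_unique _ _ _ _ _ (distribution P X)
  (distribution P Y) (pushforward P UNV) indepN.
pose m (z : R * R) : \bar R := (z.1 * z.2)%:E.
have mm : measurable_fun setT m.
  by apply/measurable_EFinP; exact: measurable_funM.
have intUNV : P.-integrable setT (m \o UNV).
  apply: (eq_integrable measurableT (-%E \o (fun w => (U w * V w)%:E))).
    by move=> w _; rewrite /m/= mulrN EFinN.
  exact: integrableN.
have E1 : (\int[pushforward P UV]_z m z = \int[P]_w (U w * V w)%:E)%E.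
  by rewrite integral_pushforward.
have E2 : (\int[pushforward P UNV]_z m z = - \int[P]_w (U w * V w)%:E)%E.
  rewrite integral_pushforward// preimage_setT -integralN.
    by apply: eq_integral => w _; rewrite /m/= mulrN EFinN.
  by apply: integrable_add_def.
have : (\int[P]_w (U w * V w)%:E = - \int[P]_w (U w * V w)%:E)%E.
  rewrite -E2 -E1; apply: eq_measure_integral => A mA _.
  by rewrite -prodUV// prodUNV.
have := integrable_fin_num measurableT intUV.
case: (\int[P]_w _)%E => // r _ [] h; congr EFin; lra.
Qed.

(** Both sides are finite measures in E, so Dynkin's theorem extends their
    equality from the pi-system to the sigma-algebra that it generates. *)
Lemma pi_system_indep {G : set (set T)} (V : T -> R) :
  measurable_fun setT V -> G `<=` measurable -> setI_closed G -> G setT ->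
  (forall E (D : set R), G E -> measurable D ->
    P (E `&` V @^-1` D) = P E * P (V @^-1` D))%E ->
  forall E (D : set R), <<s G >> E -> measurable D ->
    (P (E `&` V @^-1` D) = P E * P (V @^-1` D))%E.
Proof.
move=> mV Gm GI GT indepG E D GE mD.
have mVD : measurable (V @^-1` D) by rewrite -[_ @^-1` _]setTI; exact: mV.
have PVD0 : 0 <= fine (P (V @^-1` D)) by rewrite fine_ge0.
have PVDE : (fine (P (V @^-1` D)))%:E = P (V @^-1` D).
  by rewrite fineK// fin_num_measure.
transitivity (mscale (NngNum PVD0) P E); last by rewrite /mscale/= PVDE muleC.
apply: (g_sigma_algebra_measure_unique G Gm (fun=> setT) _ _
  (mrestr P mVD) (mscale (NngNum PVD0) P)) => //.
- by apply/seteqP; split=> // x _; exists 0%N.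
- by move=> A GA; rewrite /= /mscale/= PVDE muleC -indepG.
- move=> _; rewrite [ltLHS](_ : _ = P (V @^-1` D)); last by rewrite /= /mrestr setTI.
  by rewrite -ge0_fin_numE// fin_num_measure.
Qed.

Lemma measure_preimage_ae0 (X : T -> R) (B : set R) (Q : set T) :
  measurable_fun setT X -> {ae P, forall w, X w = 0} ->
  measurable B -> measurable Q ->
  P (X @^-1` B `&` Q) = if 0 \in B then P Q else 0%E.
Proof.
move=> mX X0 mB mQ.
have mXB : measurable (X @^-1` B) by rewrite -[_ @^-1` _]setTI; exact: mX.
have null (A : set T) : measurable A -> (A `<=` [set w | X w != 0]) -> P A = 0%E.
  move=> mA A0; apply/negligibleP => //; apply: negligibleS X0.
  by move=> w /A0/eqP.
case: ifPn => [/set_mem B0|/negP B0].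
  rewrite [RHS](measureDI _ mQ mXB) setIC [X in (_ = X + _)%E]null ?add0e//.
    exact: measurableD.
  by move=> w [_ XB] /=; apply/eqP => Xw; apply: XB; rewrite /= Xw.
apply: null; first exact: measurableI.
by move=> w [XB _] /=; apply/eqP => Xw; apply: B0; rewrite inE -Xw.
Qed.

(** The events that prescribe X0 and every X i except X k: a pi-system.  The
    variable X0 stands for the initial value of a Brownian motion, which is
    only almost surely zero but contributes to its filtration. *)
Definition other_cylinders {n} (X0 : T -> R) (X : 'I_n -> T -> R) (k : 'I_n) :=
  [set E | exists (B0 : set R) (B : 'I_n -> set R),
    [/\ measurable B0, forall i, measurable (B i), B k = setT &
        E = X0 @^-1` B0 `&` \bigcap_i (X i @^-1` B i)]].

(** On a cylinder, mutual independence factors out the constraint on X k, and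
    the constraint on X0 has probability 0 or 1. *)
Lemma other_cylinders_indep {n} (X0 : T -> R) (X : 'I_n -> T -> R) (k : 'I_n) :
  measurable_fun setT X0 -> {ae P, forall w, X0 w = 0} ->
  (forall i, measurable_fun setT (X i)) -> mutually_independent P X ->
  forall E (D : set R), <<s other_cylinders X0 X k >> E -> measurable D ->
    (P (E `&` X k @^-1` D) = P E * P (X k @^-1` D))%E.
Proof.
move=> mX0 X00 mX indepX.
have mX0B B0 : measurable B0 -> measurable (X0 @^-1` B0).
  by move=> mB; rewrite -[_ @^-1` _]setTI; exact: mX0.
have mcap (B : 'I_n -> set R) : (forall i, measurable (B i)) ->
    measurable (\bigcap_i (X i @^-1` B i)).
  move=> mB; apply: fin_bigcap_measurable => // i _.
  by rewrite -[_ @^-1` _]setTI; exact: mX.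
apply: pi_system_indep => //.
- by move=> _ [B0 [B [mB0 mB _ ->]]]; apply: measurableI; auto.
- move=> _ _ [B0 [B [mB0 mB Bk ->]]] [C0 [C [mC0 mC Ck ->]]].
  exists (B0 `&` C0), (fun i => B i `&` C i); split.
  + exact: measurableI.
  + by move=> i; exact: measurableI.
  + by rewrite Bk Ck setIT.
  + by rewrite setIACA -bigcapI.
- exists setT, (fun=> setT); split => //.
  by rewrite preimage_setT setTI; apply/esym/bigcapT.
move=> _ D [B0 [B [mB0 mB Bk ->]]] mD.
have mXk : measurable (X k @^-1` D) by rewrite -[_ @^-1` _]setTI; exact: mX.
rewrite -setIA !measure_preimage_ae0//; last 2 first.
- exact: mcap.
- by apply: measurableI => //; exact: mcap.
case: ifPn => _; last by rewrite mul0e.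
pose C i := if i == k then D else B i.
have mC i : measurable (C i) by rewrite /C; case: ifP.
have -> : \bigcap_i (X i @^-1` B i) `&` X k @^-1` D = \bigcap_i (X i @^-1` C i).
  apply/seteqP; split=> w.
    by move=> [BX DX] i _; rewrite /C /=; case: eqP => [->//|_]; exact: BX.
  move=> CX; split; last by have := CX k I; rewrite /C/= eqxx.
  by move=> i _; have := CX i I; rewrite /C/=; case: eqP => [->|//]; rewrite Bk.
rewrite !indepX// (bigD1 k)//= [in RHS](bigD1 k)//= Bk preimage_setT.
rewrite probability_setT mul1e muleC /C eqxx; congr (_ * _)%E.
by apply: eq_bigr => i /negPf ->.
Qed.

(** * Brownian increments and the past *)

Definition increment (W : R -> T -> R) (s t : R) (w : T) : R := W t w - W s w.

(** Generators of the information carried by W at the times in A together with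
    its increment over [v, b]: what a term of a Riemann sum depends on, the
    increment over the current step excepted. *)
Definition past_and_increment (W : R -> T -> R) (A : set R) (v b : R) :=
  \bigcup_(r in A) g_sigma_algebra_preimage (W r : T -> R) `|`
    g_sigma_algebra_preimage (increment W v b).

(** The times in s, once sorted and completed into the chain
    0 <= s_1 <= ... <= s_m <= u <= v <= b, turn each W r into W 0 plus increments
    over the links of the chain that precede [u, v].  So everything is a
    function of W 0 and of the increments other than the one over [u, v]. *)
Lemma brownian_finite_indep (W : R -> T -> R) (u v b : R) (s : seq R) :
  brownian_motion P W -> 0 <= u -> u <= v -> v <= b -> b <= 1 ->
  (forall r, r \in s -> 0 <= r <= u) ->
  forall E (D : set R), <<s past_and_increment W [set` s] v b >> E ->
    measurable D ->
    (P (E `&` increment W u v @^-1` D) =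
     P E * P (increment W u v @^-1` D))%E.
Proof.
move=> bm u0 uv vb b1 su.
pose q := sort <=%R s.
pose l := 0 :: q ++ [:: u; v; b].
have sizeq : size q = size s by rewrite size_sort.
have sizel : size l = (size s).+4 by rewrite /= size_cat sizeq addnC.
pose p i := nth b l i.
have q0u : forall r, r \in q -> 0 <= r <= u.
  by move=> r; rewrite mem_sort; exact: su.
have l_le1 r : r \in l -> r <= b.
  rewrite inE mem_cat !inE => /predU1P[->|/orP[/q0u/andP[_ ru]|]]; lra.
have sorted_l : sorted <=%R l.
  rewrite (sorted_pairwise le_trans) /= pairwise_cat -(sorted_pairwise le_trans).
  rewrite (sort_sorted (@le_total _ R)) /= uv vb (le_trans uv vb) !andbT.
  apply/andP; split.
    rewrite all_cat /= u0 (le_trans u0 uv) (le_trans (le_trans u0 uv) vb)/= andbT.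
    by apply/allP => r /q0u/andP[].
  apply/allrelP => x y /q0u/andP[_ xu].
  by rewrite !inE => /or3P[] /eqP ->; lra.
have p_homo : {homo p : i j / (i <= j)%N >-> i <= j}.
  move=> i j ij; have [jl|lj] := ltnP j (size l).
    apply: (sorted_leq_nth le_trans le_refl) => //.
    by rewrite inE (leq_ltn_trans ij).
  rewrite {2}/p nth_default//.
  have [il|li] := ltnP i (size l); last by rewrite /p nth_default.
  by apply: l_le1; exact: mem_nth.
have pn : p (size s).+3 <= 1.
  by rewrite (le_trans _ b1)// l_le1// mem_nth// sizel.
have p01 i : 0 <= p i <= 1.
  rewrite (_ : 0 = p 0%N)// p_homo//=.
  have [il|li] := ltnP i (size l); last by rewrite /p nth_default.
  by rewrite (le_trans _ b1)// l_le1// mem_nth.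
have pu : p (size s).+1 = u by rewrite /p /= nth_cat sizeq ltnn subnn.
have pv : p (size s).+2 = v.
  by rewrite /p /= nth_cat sizeq ltnNge leqnSn/= subSnn.
have pb : p (size s).+3 = b.
  by rewrite /p /= nth_cat sizeq ltnNge (leqW (leqnSn _))/= -addn2 addKn.
have mW i : measurable_fun setT (W (p i)).
  by apply: (bm_measurable bm); rewrite in_itv/=.
pose n := (size s).+3.
(* The link [u, v] of the chain has index (size s).+1. *)
have kn : ((size s).+1 < n)%N by [].
pose k := Ordinal kn.
pose X (i : 'I_n) := increment W (p i) (p i.+1).
have mX i : measurable_fun setT (X i) by exact: measurable_funB.
have indepX : mutually_independent P X by exact: (bm_increments bm).
have p0 : p 0%N = 0 by [].
have W00 : {ae P, forall w, W (p 0%N) w = 0} by rewrite p0; exact: (bm_start bm).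
pose C := other_cylinders (W (p 0%N)) X k.
have CX0 (B : set R) : measurable B -> <<s C >> (W (p 0%N) @^-1` B).
  move=> mB; apply: sub_sigma_algebra; exists B, (fun=> setT); split => //.
  rewrite (_ : \bigcap_i _ = setT) ?setIT//.
  by apply: bigcapT => // i _; rewrite preimage_setT.
have CX i (B : set R) : i != k -> measurable B -> <<s C >> (X i @^-1` B).
  move=> ik mB; apply: sub_sigma_algebra.
  exists setT, (fun j => if j == i then B else setT); split => //.
  - by move=> j; case: ifP.
  - by rewrite eq_sym (negPf ik).
  - rewrite preimage_setT setTI; apply/seteqP; split=> w.
      by move=> XB j _ /=; case: eqP => [->|].
    by move/(_ i I); rewrite /= eqxx.
(* Up to time u, W is the telescoping sum of W 0 and of links other than k. *)
have CW i : (i <= (size s).+1)%N ->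
    measurable_fun setT (W (p i) : g_sigma_algebraType C -> R).
  elim: i => [_ _ B mB|i IH /[dup] iS /ltnW /IH mWi].
    by rewrite setTI; exact: CX0.
  have iSn : (i < n)%N by rewrite (leq_trans iS)// leqW.
  rewrite (_ : W _ = W (p i) \+ X (Ordinal iSn)); last first.
    by apply/funext => w; rewrite /X /increment/= addrC subrK.
  apply: measurable_funD => // _ B mB; rewrite setTI; apply: CX => //.
  by rewrite -val_eqE /= ltn_eqF.
move=> E D sE mD.
have -> : increment W u v = X k by rewrite /X /= pu pv.
apply: (other_cylinders_indep _ _ k (mW 0%N) W00 mX indepX) => //.
suff : past_and_increment W [set` s] v b `<=` <<s C >>.
  by move=> KC; apply: smallest_sub sE => //; exact: smallest_sigma_algebra.
move=> A [[r /= rs]|].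
  have rl : r \in 0 :: q by rewrite inE mem_sort rs orbT.
  move=> [B mB <-]; have il := rl; rewrite -index_mem /= sizeq in il.
  rewrite setTI; have -> : r = p (index r (0 :: q)).
    by rewrite /p /l -cat_cons nth_cat index_mem rl nth_index.
  by rewrite -[X in <<s _ >> X]setTI; apply: CW => //; exact: ltnW.
move=> [B mB <-]; rewrite setTI.
have bn : ((size s).+2 < n)%N by [].
rewrite (_ : increment W v b = X (Ordinal bn)); last by rewrite /X/= pv pb.
by apply: CX => //; rewrite -val_eqE /= gtn_eqF.
Qed.

Lemma past_and_increment_measurable (W : R -> T -> R) (A : set R) (v b : R) :
  brownian_motion P W -> A `<=` `[0, 1]%classic -> 0 <= v -> v <= b -> b <= 1 ->
  <<s past_and_increment W A v b >> `<=` measurable.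
Proof.
move=> bm A01 v0 vb b1; apply: smallest_sub; first exact: sigma_algebra_measurable.
move=> E [[r /A01 r01]|] [B mB <-].
  by apply: (bm_measurable bm).
apply: measurable_funB => //; apply: (bm_measurable bm); rewrite in_itv/=; lra.
Qed.

(** The sigma-algebras generated by finitely many past times are directed by
    concatenation of lists, so their union is a pi-system to which the finite
    case applies. *)
Lemma brownian_increment_indep (W : R -> T -> R) (u v b : R) :
  brownian_motion P W -> 0 <= u -> u <= v -> v <= b -> b <= 1 ->
  forall E (D : set R),
    <<s past_and_increment W `[0, u]%classic v b >> E -> measurable D ->
    (P (E `&` increment W u v @^-1` D) =
     P E * P (increment W u v @^-1` D))%E.
Proof.
move=> bm u0 uv vb b1.
have mV : measurable_fun setT (increment W u v).
  by apply: measurable_funB; apply: (bm_measurable bm); rewrite in_itv/=; lra.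
pose past : set (seq R) := [set s : seq R | forall r : R, r \in s -> 0 <= r <= u].
pose G := \bigcup_(s in past) <<s past_and_increment W [set` s] v b >>.
have Gmono s1 s2 : {subset s1 <= s2} ->
    <<s past_and_increment W [set` s1] v b >> `<=`
    <<s past_and_increment W [set` s2] v b >>.
  move=> s12; apply: smallest_sub; first exact: smallest_sigma_algebra.
  move=> E H; apply: sub_sigma_algebra; case: H => [[r rs Er]|]; last by right.
  by left; exists r => //; exact: s12.
have GI : setI_closed G.
  move=> E1 E2 [s1 s1u E1s] [s2 s2u E2s]; exists (s1 ++ s2).
    by move=> r; rewrite mem_cat => /orP[/s1u|/s2u].
  apply: (@measurableI _ (g_sigma_algebraType
    (past_and_increment W [set` s1 ++ s2] v b))).
    by apply: Gmono E1s => r; rewrite mem_cat => ->.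
  by apply: Gmono E2s => r; rewrite mem_cat => ->; rewrite orbT.
have indepG E (D : set R) : <<s G >> E -> measurable D ->
    (P (E `&` increment W u v @^-1` D) = P E * P (increment W u v @^-1` D))%E.
  apply: pi_system_indep => //.
  - move=> F [s su]; apply: past_and_increment_measurable => //; last lra.
    move=> r /su /andP[r0 ru]; rewrite /= in_itv/=; lra.
  - exists [::] => //.
    exact: (@measurableT _ (g_sigma_algebraType (past_and_increment W [set` [::]] v b))).
  - move=> F C [s su Fs] mC; exact: (brownian_finite_indep _ _ _ _ s bm u0 uv vb b1 su).
move=> E D KE mD; apply: indepG => //.
apply: smallest_sub KE; first exact: smallest_sigma_algebra.
move=> F H; apply: sub_sigma_algebra; case: H => [[r ru Fr]|Fb].
  exists [:: r]; first by move=> r'; rewrite inE => /eqP ->.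
  by apply: sub_sigma_algebra; left; exists r => //=; rewrite inE.
by exists [::] => //; apply: sub_sigma_algebra; right.
Qed.

Lemma increment_symmetric (W : R -> T -> R) (u v : R) (D : set R) :
  brownian_motion P W -> 0 <= u -> u < v -> v <= 1 -> measurable D ->
  P (increment W u v @^-1` (-%R @^-1` D)) = P (increment W u v @^-1` D).
Proof.
move=> bm u0 uv v1 mD; rewrite !(bm_gaussian bm)//.
  by rewrite normal_prob_oppr// gt_eqF// sqrtr_gt0 subr_gt0.
by rewrite -[_ @^-1` _]setTI; exact: oppr_measurable.
Qed.

(** One term of a Riemann sum: restricted to A, its coefficient is measurable
    with respect to the past and the increment over [v, b], hence independent
    of the symmetric increment over [u, v]. *)
Lemma integral_past_increment (W : R -> T -> R) (Theta : R -> R -> R)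
    (s u v b : R) (A : set T) :
  brownian_motion P W -> continuous (fun z : R * R => Theta z.1 z.2) ->
  0 <= s -> s <= u -> u < v -> v <= b -> b <= 1 ->
  generated_filtration W s A ->
  P.-integrable setT
    (fun w => (Theta (W u w) (increment W v b w) * increment W u v w)%:E) ->
  (\int[P]_(w in A)
     (Theta (W u w) (increment W v b w) * increment W u v w)%:E = 0)%E.
Proof.
move=> bm cTheta s0 su uv vb b1 FA intf.
have u0 : 0 <= u by exact: le_trans su.
pose K := past_and_increment W `[0, u]%classic v b.
have KT : <<s K >> `<=` measurable.
  apply: past_and_increment_measurable => //; last lra.
  by move=> r /=; rewrite !in_itv/= => /andP[r0 ru]; lra.
have KA : <<s K >> A.
  apply: smallest_sub FA; first exact: smallest_sigma_algebra.
  move=> E [r /= rs Er]; apply: sub_sigma_algebra; left; exists r => //=.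
  by move: rs; rewrite !in_itv/=; lra.
have mWu : measurable_fun setT (W u : g_sigma_algebraType K -> R).
  move=> _ B mB; rewrite setTI; apply: sub_sigma_algebra; left.
  by exists u; [rewrite /= in_itv/= u0 lexx|exists B; rewrite ?setTI].
have mWvb : measurable_fun setT (increment W v b : g_sigma_algebraType K -> R).
  move=> _ B mB; rewrite setTI; apply: sub_sigma_algebra; right.
  by exists B; rewrite ?setTI.
pose U w : R := \1_A w * Theta (W u w) (increment W v b w).
have mUK : measurable_fun setT (U : g_sigma_algebraType K -> R).
  apply: measurable_funM; first exact: measurable_indic.
  apply: (@measurableT_comp _ _ _ _ _ _ (fun z : R * R => Theta z.1 z.2)
    _ (fun w : g_sigma_algebraType K => (W u w, increment W v b w))).
    exact: continuous_measurable_fun2.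
  exact: measurable_fun_pair.
have UK (B : set R) : measurable B -> <<s K >> (U @^-1` B).
  by move=> mB; rewrite -[X in <<s _ >> X]setTI; exact: mUK.
have mU : measurable_fun setT U.
  by move=> _ B mB; rewrite setTI; apply: KT; exact: UK.
have mV : measurable_fun setT (increment W u v).
  by apply: measurable_funB; apply: (bm_measurable bm); rewrite in_itv/=; lra.
rewrite integral_mkcond.
transitivity (\int[P]_w (U w * increment W u v w)%:E)%E.
  apply: eq_integral => w _; rewrite /patch /U indicE.
  by case: ifP; rewrite ?mul1r// !mul0r.
apply: integral_indep_symmetric => //.
- move=> B D mB mD; apply: (brownian_increment_indep _ _ _ b) => //; first exact: ltW.
  exact: UK.
- by move=> D mD; apply: increment_symmetric => //; lra.
- apply: le_integrable intf => //.
    by apply/measurable_EFinP; exact: measurable_funM.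
  move=> w _; rewrite lee_fin /U indicE -mulrA normrM ler_piMl//.
  by case: (_ \in _); rewrite ?normr1 ?normr0.
Qed.

(** * Uniform integrability and limits in probability *)

Lemma measurable_abs_ge (X : T -> R) (K : R) : measurable_fun setT X ->
  measurable [set w | K <= `|X w|].
Proof.
move=> mX; rewrite (_ : [set _ | _] = (Num.norm \o X) @^-1` `[K, +oo[%classic).
  by rewrite -[_ @^-1` _]setTI; apply: (measurableT_comp (@normr_measurable _ _) mX).
by apply/seteqP; split=> w /=; rewrite in_itv/= andbT.
Qed.

(** The uniform absolute continuity hidden in a tail bound: on G, |X| is at most
    K or contributes to the tail. *)
Lemma integral_abs_le_tail (X : T -> R) (G : set T) (K : R) :
  measurable_fun setT X -> measurable G -> 0 <= K ->
  (\int[P]_(w in G) `|X w|%:E <=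
   K%:E * P G + \int[P]_(w in [set w | (K <= `|X w|)%R]) `|X w|%:E)%E.
Proof.
move=> mX mG K0; set H := [set w | _].
have mH : measurable H by exact: measurable_abs_ge.
have mabs (D : set T) : measurable_fun D (fun w => `|X w|%:E).
  apply: measurable_funTS; apply/measurable_EFinP.
  exact: (measurableT_comp (@normr_measurable _ _) mX).
rewrite -[X in integral _ X](setUIDK G H) ge0_integral_setU//; last 3 first.
- exact: measurableI.
- exact: measurableD.
- by apply/disj_setPRL => w [_ nH] [_ /nH].
rewrite addeC; apply: leeD; last first.
  apply: ge0_subset_integral => //; exact: measurableI.
have mGH : measurable (G `\` H) by exact: measurableD.
apply: (@le_trans _ _ (\int[P]_(w in G `\` H) (cst K%:E w))%E).
  apply: ge0_le_integral => //.
  by move=> w [_ /negP]; rewrite -ltNge lee_fin => /ltW.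
rewrite integral_cst// lee_wpmul2l ?lee_fin// le_measure// ?inE//.
Qed.

Lemma uniformly_integrable_integrable (S : set (T -> R)) (X : T -> R) :
  uniformly_integrable P S -> S X -> P.-integrable setT (EFin \o X).
Proof.
move=> [mS /(_ 1 ltr01)[K tailK]] SX; have mX := mS X SX.
apply/integrableP; split; first exact/measurable_EFinP.
have := integral_abs_le_tail X setT `|K| mX measurableT (normr_ge0 K).
move=> /le_lt_trans; apply; rewrite probability_setT mule1.
apply: (@le_lt_trans _ _ (`|K|%:E + 1%:E)%E); last by rewrite -EFinD ltry.
apply: leeD => //; apply: le_trans (tailK X SX).
apply: ge0_subset_integral => //; try exact: measurable_abs_ge.
- apply: measurable_funTS; apply/measurable_EFinP.
  exact: (measurableT_comp (@normr_measurable _ _) mX).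
- by move=> w /=; apply: le_trans; exact: ler_norm.
Qed.


(** Dominated convergence for the tails over [n <= |X|], dominated by |X|. *)
Lemma integrable_tail (X : T -> R) (eps : R) :
  P.-integrable setT (EFin \o X) -> 0 < eps ->
  exists K : R, 0 <= K /\
    (\int[P]_(w in [set w | (K <= `|X w|)%R]) `|X w|%:E <= eps%:E)%E.
Proof.
move=> intX eps0.
have mX : measurable_fun setT X by apply/measurable_EFinP; exact: measurable_int intX.
pose H (n : nat) := [set w | n%:R <= `|X w|].
pose f (n : nat) : T -> \bar R := (fun w => `|X w|%:E) \_ (H n).
have mH n : measurable (H n) by exact: measurable_abs_ge.
have mabs (D : set T) : measurable_fun D (fun w => `|X w|%:E).
  apply: measurable_funTS; apply/measurable_EFinP.
  exact: (measurableT_comp (@normr_measurable _ _) mX).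
have [] := @dominated_convergence _ _ _ P setT measurableT f (cst 0%E) 
  (fun w => `|X w|%:E).
- move=> n; apply/(measurable_restrictT _ (mH n)). exact: mabs.
- exact: measurable_cst.
- apply: aeW => w _; apply: cvg_near_cst; near=> n.
  rewrite /f /patch; case: ifPn => // /set_mem; rewrite /H /= leNgt.
  move=> /negP; elim; near: n; exact: nbhs_infty_gtr.
- exact: integrable_abse intX.
- apply: aeW => w n _; rewrite /f /patch; case: ifPn => _ /=.
    by rewrite normr_id.
  by rewrite normr0 lee_fin.
move=> _ _ /=; rewrite integral_cst// mul0e => /fine_cvgP[ffin /cvgr_lt].
move=> /(_ _ eps0) flt.
have [N _ HN] := filterI ffin flt.
have [] := HN N (leqnn N) => fN_fin fN_lt.
exists N%:R; split => //; rewrite integral_mkcond -/(H N) -/(f N).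
by rewrite -(fineK fN_fin) lee_fin ltW.
Unshelve. all: by end_near. Qed.

(** Vitali's argument in the form needed here.  If Y in S is within eps of X off
    a set G of small probability, then |X - Y| integrates to at most eps off G
    and, by the tail bounds for X and for S, to little on G. *)
Lemma uniformly_integrable_limit (S : set (T -> R)) (X : T -> R) (A : set T) :
  uniformly_integrable P S -> P.-integrable setT (EFin \o X) ->
  measurable A ->
  (forall eps delta : R, 0 < eps -> 0 < delta -> exists Y, [/\ S Y,
     (P [set w | (eps <= `|Y w - X w|)%R] <= delta%:E)%E &
     (\int[P]_(w in A) (Y w)%:E = 0)%E]) ->
  (\int[P]_(w in A) (X w)%:E = 0)%E.
Proof.
move=> UI intX mA approx; have [mS tailS] := UI.
have mX : measurable_fun setT X by apply/measurable_EFinP; exact: measurable_int intX.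
apply/eqP; rewrite -abse_eq0 eq_le abse_ge0 andbT.
apply/lee_addgt0Pr => e e0; rewrite add0e.
(* Four errors add up to e: one off G, two tails on G, and (K + L) P(G). *)
have e4 : 0 < e / 4 by rewrite divr_gt0.
have [K0 tK0] := tailS _ e4; have [L [L0 tL]] := integrable_tail X _ intX e4.
pose K := `|K0|.
have K_ge0 : 0 <= K by exact: normr_ge0.
have KL1 : 0 < K + L + 1 by lra.
have [Y [SY YX YA]] := approx _ _ e4 (divr_gt0 e4 KL1).
set delta := e / 4 / (K + L + 1) in YX.
have delta0 : 0 < delta by exact: divr_gt0.
have intY := uniformly_integrable_integrable S Y UI SY.
have mY := mS Y SY.
have mabs (Z : T -> R) (D : set T) : measurable_fun setT Z ->
    measurable_fun D (fun w => `|Z w|%:E).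
  move=> mZ; apply: measurable_funTS; apply/measurable_EFinP.
  exact: (measurableT_comp (@normr_measurable _ _) mZ).
have mYX : measurable_fun setT (fun w => Y w - X w) by exact: measurable_funB.
pose G := [set w | e / 4 <= `|Y w - X w|].
have mG : measurable G by exact: measurable_abs_ge.
have PG : (P G <= delta%:E)%E by [].
have tY : (\int[P]_(w in G) `|Y w|%:E <= (K * delta)%:E + (e / 4)%:E)%E.
  apply: le_trans (integral_abs_le_tail Y G K mY mG K_ge0) _.
  apply: leeD; first by rewrite EFinM lee_wpmul2l ?lee_fin.
  apply: le_trans (tK0 Y SY); apply: ge0_subset_integral; try exact: measurable_abs_ge.
  - exact: mabs.
  - by move=> w _; rewrite lee_fin.
  - by move=> w /=; apply: le_trans; exact: ler_norm.
have tX : (\int[P]_(w in G) `|X w|%:E <= (L * delta)%:E + (e / 4)%:E)%E.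
  apply: le_trans (integral_abs_le_tail X G L mX mG L0) _.
  by apply: leeD => //; rewrite EFinM lee_wpmul2l ?lee_fin.
have GXY : (\int[P]_(w in G) `|Y w - X w|%:E <=
    (K * delta)%:E + (e / 4)%:E + ((L * delta)%:E + (e / 4)%:E))%E.
  apply: le_trans (leeD tY tX); rewrite -ge0_integralD//; try exact: mabs.
  apply: ge0_le_integral => //; first exact: mabs.
    by apply: emeasurable_funD; exact: mabs.
  by move=> w _; rewrite -EFinD lee_fin ler_normB.
have GCXY : (\int[P]_(w in ~` G) `|Y w - X w|%:E <= (e / 4)%:E)%E.
  apply: (@le_trans _ _ (\int[P]_(w in ~` G) (cst (e / 4)%:E w))%E).
    apply: ge0_le_integral => //; [exact: measurableC| exact: mabs|].
    by move=> w /negP; rewrite -ltNge lee_fin => /ltW.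
  rewrite integral_cst//; last exact: measurableC.
  rewrite -[leRHS]mule1 lee_wpmul2l ?lee_fin ?(ltW e4)//.
  by apply: probability_le1; exact: measurableC.
have -> : (\int[P]_(w in A) (X w)%:E = - \int[P]_(w in A) (Y w - X w)%:E)%E.
  under [X in (_ = - X)%E]eq_integral do rewrite EFinB.
  rewrite integralB_EFin//; last 2 first.
  - by apply: integrableS intY.
  - by apply: integrableS intX.
  by rewrite YA sub0e oppeK.
rewrite abseN; apply: le_trans (le_abse_integral _ _ _) _ => //.
  by apply/measurable_EFinP; exact: measurable_funTS.
apply: (@le_trans _ _ (\int[P]_w `|Y w - X w|%:E)%E).
  by apply: ge0_subset_integral => //; exact: mabs.
rewrite -(setUv G) ge0_integral_setU//; last 3 first.
- exact: measurableC.
- exact: mabs.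
- by apply/disj_setPCl.
apply: le_trans (leeD GXY GCXY) _.
rewrite -!EFinD lee_fin.
have : (K + L + 1) * delta = e / 4 by rewrite /delta mulrC divfK// gt_eqF.
nra.
Qed.

(** * Riemann sums along partitions *)

Definition mesh_lt (alpha beta delta : R) (p : seq R) :=
  forall i, (i < size p)%N ->
    nth beta (alpha :: p) i.+1 - nth beta (alpha :: p) i < delta.


(** The default value of nth is the right end of the partition, so it changes
    when partitions are concatenated; it is never reached. *)
Lemma nth_cat_partition_left (a s t : R) (q p : seq R) i :
  (i <= size q)%N -> nth t (a :: q ++ p) i = nth s (a :: q) i.
Proof.
move=> iq; rewrite -cat_cons nth_cat /= ltnS iq.
by apply: set_nth_default; rewrite /= ltnS.
Qed.

Lemma nth_cat_partition_right (a s t : R) (q p : seq R) i :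
  itv_partition a s q -> nth t (a :: q ++ p) (size q + i) = nth t (s :: p) i.
Proof.
move=> [_ /eqP <-]; rewrite -cat_cons lastI cat_rcons nth_cat size_belast.
by rewrite ltnNge leq_addr addKn.
Qed.

Lemma mesh_lt_cat (a s t delta : R) (q p : seq R) :
  itv_partition a s q -> mesh_lt a s delta q -> mesh_lt s t delta p ->
  mesh_lt a t delta (q ++ p).
Proof.
move=> qs qd pd i; rewrite size_cat => iqp; have [iq|qi] := ltnP i (size q).
  by rewrite !(nth_cat_partition_left _ s) ?(ltnW iq)//; exact: qd.
rewrite -(subnKC qi) -addnS !(nth_cat_partition_right _ s)//.
by apply: pd; rewrite ltn_subLR.
Qed.

Lemma riemann_sum_cat (W : R -> T -> R) (H : R -> R -> T -> R) (a s t : R)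
    (q p : seq R) (w : T) : itv_partition a s q ->
  riemann_sum W H a t (q ++ p) w =
  riemann_sum W H a s q w + riemann_sum W H s t p w.
Proof.
move=> qs; rewrite /riemann_sum (@big_cat_nat _ _ _ (size q))//=; last first.
  by rewrite size_cat leq_addr.
congr (_ + _).
  apply: eq_big_nat => i /andP[_ iq].
  by rewrite -[nth t (q ++ p) i]/(nth t (a :: q ++ p) i.+1)
    !(nth_cat_partition_left _ s) ?(ltnW iq).
rewrite -{1}[size q]add0n big_addn size_cat addKn.
apply: eq_big_nat => i _.
rewrite -[nth t (q ++ p) (i + size q)]/(nth t (a :: q ++ p) (i + size q).+1).
by rewrite addnC -addnS !(nth_cat_partition_right _ s).
Qed.

(** Steps of length delta / 2, to stay strictly below delta, the last one being
    cut at beta. *)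
Lemma exists_fine_partition (alpha beta delta : R) :
  alpha <= beta -> 0 < delta ->
  exists p, itv_partition alpha beta p /\ mesh_lt alpha beta delta p.
Proof.
move=> ab d0; have [n] : exists n, beta - alpha <= (delta / 2) *+ n.
  exists (Num.truncn ((beta - alpha) / (delta / 2))).+1.
  rewrite -mulr_natl -ler_pdivrMr ?divr_gt0//.
  by apply: ltW; apply: truncnS_gt.
elim: n alpha ab => [|n IH] alpha ab.
  rewrite mulr0n subr_le0 => ba; have -> : alpha = beta by apply/le_anti/andP.
  by exists [::]; split => //; split => //=.
rewrite mulrSr => ban.
have [ltb|geb] := ltP (alpha + delta / 2) beta.
  have [||p [[pp /eqP lp] pd]] := IH (alpha + delta / 2); try lra.
  exists (alpha + delta / 2 :: p); split.
    by split => //=; [rewrite pp andbT ltrDl divr_gt0|rewrite lp].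
  by move=> [_ /=|i /= ip]; [lra|exact: pd].
have [->|ab'] := eqVneq alpha beta.
  by exists [::]; split => //; split => //=.
exists [:: beta]; split; first by apply: itv_partition1; rewrite lt_neqAle ab'.
by move=> [_ /=|//]; lra.
Qed.
(** Sums over a degenerate interval are left out of this family, so empty
    partitions have to be treated apart below. *)
Definition riemann_sums (W : R -> T -> R) (Theta : R -> R -> R) (a b : R) :=
  [set S | exists (s t : R) (p : seq R),
        [/\ a <= s, s < t, t <= b, itv_partition s t p &
            S = riemann_sum W
                  (fun u v w => Theta (W u w) (W b w - W v w)) s t p]].

(** Induction on the partition.  Splitting off the first step leaves a one-step
    Riemann sum and a shorter one; both lie in the uniformly integrable family,
    so each is integrable by itself and linearity applies. *)
Lemma integral_riemann_sum (W : R -> T -> R) (Theta : R -> R -> R)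
    (a b r s t : R) (p : seq R) (A : set T) :
  brownian_motion P W -> continuous (fun z : R * R => Theta z.1 z.2) ->
  uniformly_integrable P (riemann_sums W Theta a b) ->
  0 <= a -> b <= 1 -> a <= r -> r <= s -> t <= b ->
  itv_partition s t p -> measurable A -> generated_filtration W r A ->
  (\int[P]_(w in A) (riemann_sum W
     (fun u v w => Theta (W u w) (W b w - W v w)) s t p w)%:E = 0)%E.
Proof.
move=> bm cTheta UI a0 b1 ar + tb + mA FA.
elim: p s => [s _ _|x p IH s rs sp].
  by apply: integral0_eq => w _; rewrite /riemann_sum big_geq.
have sx : s < x by case: sp => /= /andP[].
have sx_part : itv_partition s x [:: x] by exact: itv_partition1.
have xt_part : itv_partition x t p by exact: itv_partition_cons sp.
have xt : x <= t by exact: itv_partition_le xt_part.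
pose H u v w := Theta (W u w) (W b w - W v w); rewrite -/H.
have intx : P.-integrable setT (EFin \o riemann_sum W H s x [:: x]).
  apply: uniformly_integrable_integrable UI _; exists s, x, [:: x].
  by split => //; lra.
have int0 : (\int[P]_(w in A) (riemann_sum W H s x [:: x] w)%:E = 0)%E.
  have sumE w : riemann_sum W H s x [:: x] w =
    Theta (W s w) (increment W x b w) * increment W s x w.
    by rewrite /riemann_sum big_nat1.
  under eq_integral do rewrite sumE.
  apply: (integral_past_increment W Theta r s x b A) => //; try lra.
  by apply: eq_integrable intx => // w _ /=; rewrite sumE.
(* The remaining sum is empty, hence outside the family, when x = t. *)
have intp : P.-integrable setT (EFin \o riemann_sum W H x t p).
  move: xt; rewrite le_eqVlt => /predU1P[xt|xt].
    move: xt_part; rewrite xt => /itv_partitionxx ->.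
    rewrite (_ : _ \o _ = cst 0%E); first exact: integrable0.
    by apply/funext => w; rewrite /= /riemann_sum big_geq.
  apply: uniformly_integrable_integrable UI _; exists x, t, p.
  by split => //; lra.
under eq_integral do rewrite (riemann_sum_cat W H s x t [:: x]) // EFinD.
rewrite integralD_EFin//; last 2 first.
- exact: integrableS intx.
- exact: integrableS intp.
by rewrite int0 add0e IH//; lra.
Qed.

Lemma cvg_in_prob_fine_partition (S : seq R -> T -> R) (X : T -> R)
    (alpha beta eps eta : R) :
  cvg_in_prob P (mesh_to_0 alpha beta) S X -> 0 < eps -> 0 < eta ->
  exists2 delta : R, 0 < delta & forall p, itv_partition alpha beta p ->
    mesh_lt alpha beta delta p ->
    (P [set w | (eps <= `|S p w - X w|)%R] < eta%:E)%E.
Proof.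
move=> cvgS eps0 eta0.
have : nbhs (0%E : \bar R) [set x | (x < eta%:E)%E].
  by apply: open_nbhs_nbhs; split; [exact: open_ereal_lt_ereal|rewrite /= lte_fin].
by move=> /(cvgS eps eps0)[delta d0 H]; exists delta.
Qed.

End Probability.

(** * The near-martingale property *)

Theorem theorem3p3 (d : measure_display) (T : measurableType d) (R : realType)
    (P : probability T R) (a b : R) (W : R -> T -> R) (Theta : R -> R -> R)
    (N : R -> T -> R)
    (ha : 0 <= a) (hab : a < b) (hb : b <= 1)
    (hW : brownian_motion P W)
    (hTheta : continuous (fun z : R * R => Theta z.1 z.2))
    (hN : forall t : R, t \in `[a, b] ->
      AK_integral P W (generated_filtration W) a t
        (fun s w => Theta (W s w) (W b w - W s w)) (N t))
    (hsum : forall t : R, t \in `[a, b] ->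
      cvg_in_prob P (mesh_to_0 a t)
        (riemann_sum W (fun u v w => Theta (W u w) (W b w - W v w)) a t) (N t))
    (hint : forall t : R, t \in `[a, b] ->
      P.-integrable setT (fun w => (N t w)%:E))
    (hUI : uniformly_integrable P
      [set S | exists (s t : R) (p : seq R),
        [/\ a <= s, s < t, t <= b, itv_partition s t p &
            S = riemann_sum W
                  (fun u v w => Theta (W u w) (W b w - W v w)) s t p]]) :
  near_martingale P (generated_filtration W) a b N.
Proof.
pose H u v w := Theta (W u w) (W b w - W v w).
rewrite -/H in hsum *.
have N_int s t : a <= s -> s <= t -> t <= b ->
    P.-integrable setT (EFin \o (fun w => N t w - N s w)).
  move=> a_s st tb; rewrite (_ : _ \o _ =
    (fun w => (N t w)%:E) \- (fun w => (N s w)%:E))%E//.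
  by apply: integrableB => //; apply: hint; rewrite in_itv/=; lra.
have mN t : t \in `[a, b] -> measurable_fun setT (N t).
  by move=> tab; apply/measurable_EFinP; exact: measurable_int (hint t tab).
split=> [t tab|s t a_s st tb]; first exact: hint.
exists (cst 0); last exact: aeW.
split.
- move=> B mB; rewrite preimage_cst; case: ifP => _.
    exact: (@measurableT _ (g_sigma_algebraType _)).
  exact: (@measurable0 _ (g_sigma_algebraType _)).
- exact: integrable0.
move=> A FA.
have mA : measurable A.
  apply: smallest_sub FA; first exact: sigma_algebra_measurable.
  move=> _ [r /= rs [B mB <-]].
  by apply: (bm_measurable hW) => //; move: rs; rewrite !in_itv/=; lra.
rewrite integral0_eq//; apply/esym.
move: st; rewrite le_eqVlt => /predU1P[<-|st].
  by apply: integral0_eq => w _; rewrite subrr.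
have sab : s \in `[a, b] by rewrite in_itv/=; lra.
have tab : t \in `[a, b] by rewrite in_itv/=; lra.
apply: (uniformly_integrable_limit (riemann_sums W Theta a b)) => //.
  by apply: N_int => //; exact: ltW.
move=> eps delta eps0 delta0.
have eps2 : 0 < eps / 2 by rewrite divr_gt0.
have delta2 : 0 < delta / 2 by rewrite divr_gt0.
have [d1 d10 Hs] := cvg_in_prob_fine_partition _ _ _ _ _ _ (hsum s sab) eps2 delta2.
have [d2 d20 Ht] := cvg_in_prob_fine_partition _ _ _ _ _ _ (hsum t tab) eps2 delta2.
pose m := Num.min d1 d2.
have m0 : 0 < m by rewrite lt_min d10.
(* q subdivides [a, s] and p subdivides [s, t]: q ++ p has a node at s. *)
have [q [qs qm]] := exists_fine_partition a s m a_s m0.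
have [p [pt pm]] := exists_fine_partition s t m (ltW st) m0.
have qpt : itv_partition a t (q ++ p) by exact: itv_partition_cat qs pt.
pose Sq := riemann_sum W H a s q; pose Sqp := riemann_sum W H a t (q ++ p).
(* For s = a the partition q is empty, and its sum is null. *)
have mSq : measurable_fun setT Sq.
  move: (a_s); rewrite le_eqVlt => /predU1P[as_eq|a_lt_s].
    rewrite /Sq; move: qs; rewrite as_eq => /itv_partitionxx ->.
    by rewrite /riemann_sum; under eq_fun do rewrite big_geq//; exact: measurable_cst.
  by apply: hUI.1; exists a, s, q; split => //; lra.
have mSqp : measurable_fun setT Sqp.
  by apply: hUI.1; exists a, t, (q ++ p); split => //; lra.
exists (riemann_sum W H s t p); split.
- by exists s, t, p.
(* The sum over p is the difference of the sums over q ++ p and over q. *)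
- have -> : [set w | eps <= `|riemann_sum W H s t p w - (N t w - N s w)|] =
      [set w | eps <= `|(Sqp w - N t w) - (Sq w - N s w)|].
    apply/seteqP; split=> w /=; rewrite /Sqp (riemann_sum_cat W H a s t)// -/(Sq w);
    by rewrite (_ : _ - (Sq w - _) = riemann_sum W H s t p w - (N t w - N s w)) //; ring.
  have mset (X Y : T -> R) (e : R) : measurable_fun setT X -> measurable_fun setT Y ->
      measurable [set w | e <= `|X w - Y w|].
    move=> mX mY; apply: (measurable_abs_ge (fun w => X w - Y w)).
    exact: measurable_funB.
  apply: (@le_trans _ _ (P ([set w | eps / 2 <= `|Sqp w - N t w|] `|`
      [set w | eps / 2 <= `|Sq w - N s w|]))).
    apply: le_measure; rewrite ?inE.
    + by apply: mset; apply: measurable_funB => //; exact: mN.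
    + by apply: measurableU; apply: mset => //; exact: mN.
    move=> w /= ew; have [|lt2] := leP (eps / 2) `|Sqp w - N t w|; first by left.
    by right; have := ler_normB (Sqp w - N t w) (Sq w - N s w); lra.
  apply: le_trans (measureU2 _ _ _) _; [by apply: mset => //; exact: mN..|].
  rewrite [delta in leRHS]splitr EFinD; apply: leeD; apply: ltW.
    apply: Ht => //; apply: mesh_lt_cat qs _ _ => i /[dup].
      by move=> /qm /lt_le_trans lt1 _; apply: lt1; rewrite ge_min lexx orbT.
    by move=> /pm /lt_le_trans lt1 _; apply: lt1; rewrite ge_min lexx orbT.
  apply: Hs => // i /qm /lt_le_trans lt1; apply: lt1.
  by rewrite ge_min lexx.
- by apply: (integral_riemann_sum W Theta a b s s t p A).
Qed.
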